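(* Let $d\ge3$, $T\subset\mathbb R$ with $|T|=n\ge d+1$, and let $P_\sigma(T)$ be a Veronese $d$-polytope whose signed $\sigma$-decomposition partitions $T$ into $d-2$ intervals $T=I_1\cup\dots\cup I_{d-2}$. If $|I_1|=\dots=|I_{d-3}|=1$ and $|I_{d-2}|=n-(d-3)$, then $P_\sigma(T)$ is a $d$-dimensional stacked polytope on $n$ vertices.
   Context: $\nu_d(t)=(1,t,\dots,t^d)$, $q_\xi(t)=\sum_{i=0}^d\xi_it^i$. A chamber $\sigma$ is the closure of a connected component of the complement in $\mathbb R^{d+1}$ of the hyperplanes $\{\xi:q_\xi(t)=0\}$, $t\in T$; $P_\sigma(T)=\mathrm{conv}\{\nu_d(t)/q_\xi(t):t\in T\}$ for any $\xi$ in the interior of $\sigma$ (combinatorial type independent of this choice). The signed $\sigma$-decomposition partitions $T$ into the maximal runs $I_1<I_2<\dots$ (in increasing order) of consecutive elements of $T$ on which $\mathrm{sgn}\,q_\xi$ is constant. A stacking of a $d$-polytope $P$ onto a facet $F$ is $\mathrm{conv}(P\cup\{p\})$ for a point $p$ beyond $F$ and beneath all other facets of $P$ (strictly on the outer side of the hyperplane of $F$ and strictly on the inner side of the hyperplanes of all other facets). A polytope is stacked if it is obtained from a $d$-simplex by a finite sequence of stackings. *)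

(* Defs.v *)
From mathcomp Require Import all_boot all_order all_algebra.
From mathcomp Require Import all_classical all_reals all_analysis.
Import Order.TTheory GRing.Theory Num.Theory.
Import numFieldNormedType.Exports.

Set Implicit Arguments.
Unset Strict Implicit.
Unset Printing Implicit Defensive.

Local Open Scope classical_set_scope.
Local Open Scope ring_scope.

Section Polytopes.
Variables (R : realType) (N : nat).
Local Notation V := 'rV[R]_N.
Implicit Types (A P F G : set V) (a p x : V) (b : R).

Definition dot a x : R := \sum_(i < N) a 0 i * x 0 i.

Definition conv A : set V := smallest (convex_set (M := V)) A.

Definition aff A : set V :=
  [set p | exists k (x : 'I_k -> V) (c : 'I_k -> R),
    [/\ forall i, A (x i), \sum_i c i = 1 & p = \sum_i c i *: x i]].

Definition affinely_independent k (x : 'I_k -> V) : Prop :=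
  forall c : 'I_k -> R,
    \sum_i c i = 0 -> \sum_i c i *: x i = 0 -> forall i, c i = 0.

(* [has_affindep A k]: A contains k affinely independent points. *)
Definition has_affindep A k : Prop :=
  exists2 x : 'I_k -> V, forall i, A (x i) & affinely_independent x.

(* The dimension of the empty set is -1, so [has_dim set0 k] never holds. *)
Definition has_dim A k : Prop := has_affindep A k.+1 /\ ~ has_affindep A k.+2.

(* The inequality [dot a x <= b] is valid on P and F is where it is tight. *)
Definition exposes a b P F : Prop :=
  (forall x, P x -> dot a x <= b) /\ F = P `&` [set x | dot a x = b].

Definition face P F : Prop := exists a b, exposes a b P F.

Definition vertices P : set V := [set v | face P [set v]].

Definition facet P F : Prop :=
  face P F /\ exists k, has_dim P k.+1 /\ has_dim F k.

(* P need not be full-dimensional in R^N.  For p in the affine hull of P, the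
   side of the hyperplane of a facet F on which p lies does not depend on the
   inequality (a, b) exposing F, so one may quantify over all of them. *)
Definition beyond P F p : Prop := forall a b, exposes a b P F -> b < dot a p.

Definition beneath P F p : Prop := forall a b, exposes a b P F -> dot a p < b.

Definition stacking P F p : Prop :=
  [/\ facet P F, aff P p, beyond P F p &
      forall G, facet P G -> G <> F -> beneath P G p].

Definition simplex d P : Prop :=
  exists2 x : 'I_d.+1 -> V, affinely_independent x & P = conv (range x).

Inductive stacked (d : nat) : set V -> Prop :=
| stacked_simplex P : simplex d P -> stacked d P
| stacked_stacking P F p :
    stacked d P -> stacking P F p -> stacked d (conv (P `|` [set p])).

End Polytopes.

Section Veronese.
Variables (R : realType) (d : nat).
Implicit Types (xi : 'rV[R]_d.+1) (T I J : set R) (s t u : R).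

Definition veronese t : 'rV[R]_d.+1 := \row_(i < d.+1) t ^+ i.

Definition q xi t : R := \sum_(i < d.+1) xi 0 i * t ^+ i.

Definition arrangement_complement T : set 'rV[R]_d.+1 :=
  [set xi | forall t, T t -> q xi t != 0].

Definition chamber T (sigma : set 'rV[R]_d.+1) : Prop :=
  exists2 xi, arrangement_complement T xi &
    sigma = closure (connected_component (arrangement_complement T) xi).

Definition veronese_polytope T xi : set 'rV[R]_d.+1 :=
  conv [set (q xi t)^-1 *: veronese t | t in T].

Definition sign_run T xi I : Prop :=
  [/\ I `<=` T, I !=set0,
      forall s t u, I s -> I t -> T u -> s < u < t -> I u &
      forall s t, I s -> I t -> Num.sg (q xi s) = Num.sg (q xi t)].

Definition maximal_sign_run T xi I : Prop :=
  sign_run T xi I /\ forall J, sign_run T xi J -> I `<=` J -> J = I.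

(* The strict order between blocks makes them pairwise disjoint; blocks are
   indexed from 0. *)
Definition signed_decomposition T xi m (I : 'I_m -> set R) : Prop :=
  [/\ T = \bigcup_i I i, forall i, maximal_sign_run T xi (I i) &
      forall i j : 'I_m, (i < j)%N -> forall s t, I i s -> I j t -> s < t].

End Veronese.

(* Main.v *)
Require Import Defs.
From mathcomp Require Import all_boot all_order all_algebra.
From mathcomp Require Import all_classical all_reals all_analysis.
From mathcomp Require Import zify ring lra.
Import Order.TTheory GRing.Theory Num.Theory.
Import numFieldNormedType.Exports.
Local Open Scope classical_set_scope.
Local Open Scope card_scope.
Local Open Scope ring_scope.

(* Put e = d - 1 and let q be [q xi], w_t the point nu_d(t) / q(t).  Let A
   consist of the singleton blocks and the two ends of the long block, so
   |A| = e, and let b_0 < b_1 < ... be the remaining points.  The divided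
   difference on the d + 2 points A, b_i < b_j < b_k kills all polynomials of
   degree at most d; its alternating coefficients, multiplied by q, give an
   affine dependency in which w_t (t in A) and w_(b_j) have positive
   coefficients, and w_(b_i) and w_(b_k) negative ones.  Hence an affine
   function that is nonnegative on A, b_0, ..., b_k and vanishes at some b_i
   with i < k is positive at b_(k+1), unless it vanishes on d + 1 points in
   general position; an affine function that vanishes at no such b_i can only
   support the facet A, b_k, and b_(k+1) is beyond that facet.  So adding
   b_2, b_3, ... in order is a sequence of stackings.
   Each w_t is a vertex because q has the sign of a polynomial r of degree
   d - 3, and r(x) (x - t)^2 then defines a supporting hyperplane touching
   only at w_t. *)

Set Implicit Arguments.
Unset Strict Implicit.
Unset Printing Implicit Defensive.

(* [all_analysis] also exports a [conv]. *)
Local Notation conv := Defs.conv.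

(** * Convex hulls and their exposed faces *)

Section ConvexHulls.
Context {R : realType} {N : nat}.
Local Notation V := 'rV[R]_N.
Implicit Types (A B C : set V) (a x y : V).

Lemma dotDr a x y : dot a (x + y) = dot a x + dot a y.
Proof.
by rewrite /dot -big_split; apply: eq_bigr => i _; rewrite mxE mulrDr.
Qed.

Lemma dotZr a k x : dot a (k *: x) = k * dot a x.
Proof.
by rewrite /dot mulr_sumr; apply: eq_bigr => i _; rewrite mxE mulrCA.
Qed.

Lemma dotBl a b x : dot (a - b) x = dot a x - dot b x.
Proof.
by rewrite /dot -sumrB; apply: eq_bigr => i _; rewrite !mxE mulrBl.
Qed.

Lemma dotZl k a x : dot (k *: a) x = k * dot a x.
Proof.
by rewrite /dot mulr_sumr; apply: eq_bigr => i _; rewrite mxE mulrA.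
Qed.

Lemma dot_sumr (I : finType) a (F : I -> V) :
  dot a (\sum_i F i) = \sum_i dot a (F i).
Proof.
elim/big_ind2: _ => [|x u y v <- <-|//]; last by rewrite dotDr.
by rewrite /dot big1 // => i _; rewrite mxE mulr0.
Qed.

(** Trades the bundled coefficients in [0, 1] of [convex_set] for plain reals strictly between 0 and
    1. *)
Lemma convex_setE A :
  convex_set (M := V) A <->
  forall x y (k : R), 0 < k -> k < 1 -> A x -> A y -> A (k *: x + (1 - k) *: y).
Proof.
rewrite convex_setW; split => [cA x y k k0 k1 Ax Ay|cA x y].
  have k01 : Itv.spec (Itv.num_sem (R := R)) (Itv.Real `[0, 1]%Z) k.
    by rewrite /Itv.spec /= /Itv.num_sem /= num_real /= in_itv /= !ltW.
  have := cA x y (mem_set Ax) (mem_set Ay) (Itv.mk k01) k0 k1.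
  by rewrite inE.
rewrite !inE => Ax Ay k k0 k1; rewrite inE; exact: cA.
Qed.

Lemma sub_conv A : A `<=` conv A.
Proof. exact: sub_gen_smallest. Qed.

Lemma conv_convex A : convex_set (M := V) (conv A).
Proof.
apply/convex_setE => x y k k0 k1 cx cy B [cB AB].
by move/convex_setE: (cB); apply => //; [apply: cx|apply: cy].
Qed.

Lemma conv_sub A C :
  (forall x y (k : R), 0 < k -> k < 1 -> C x -> C y ->
     C (k *: x + (1 - k) *: y)) ->
  A `<=` C -> conv A `<=` C.
Proof. by move=> cC; apply: smallest_sub; apply/convex_setE. Qed.

Lemma sub_conv_conv A B : A `<=` conv B -> conv A `<=` conv B.
Proof. by apply: smallest_sub; apply: conv_convex. Qed.

Lemma conv_mono A B : A `<=` B -> conv A `<=` conv B.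
Proof. by move=> AB; apply: sub_conv_conv => x /AB /sub_conv. Qed.

Lemma conv_setU_conv A B : conv (conv A `|` B) = conv (A `|` B).
Proof.
apply/seteqP; split; apply: sub_conv_conv => x.
  case=> [|Bx]; first by apply: conv_mono => y; left.
  by apply: sub_conv; right.
case=> ?; apply: sub_conv; last by right.
by left; apply: sub_conv.
Qed.

Lemma conv_set1 x : conv [set x] = [set x].
Proof.
apply/seteqP; split; last exact: sub_conv.
apply: conv_sub => // y z k _ _ -> ->.
by rewrite -scalerDl addrC subrK scale1r.
Qed.

Lemma conv_dot_le A a b : (forall x, A x -> dot a x <= b) ->
  forall x, conv A x -> dot a x <= b.
Proof.
move=> Ab; apply: conv_sub => // x y k k0 k1 xb yb.
have bE : b = k * b + (1 - k) * b by rewrite -mulrDl addrC subrK mul1r.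
by rewrite dotDr !dotZr bE lerD // ler_pM2l // subr_gt0.
Qed.

Lemma conv_dot_eq A a b : (forall x, A x -> dot a x = b) ->
  forall x, conv A x -> dot a x = b.
Proof.
move=> Ab; apply: conv_sub => // x y k k0 k1 xb yb.
by rewrite dotDr !dotZr xb yb -mulrDl addrC subrK mul1r.
Qed.

(** Equality at a proper convex combination forces equality at both ends. So the inequality,
    together with membership in the hull of the tight generators whenever it is tight, passes from
    the generators to their hull. *)
Lemma conv_exposed A a b : (forall x, A x -> dot a x <= b) ->
  exposes a b (conv A) (conv (A `&` [set x | dot a x = b])).
Proof.
move=> Ab; split; first exact: conv_dot_le.
apply/seteqP; split.
  move=> x cx; split; first by apply: conv_mono cx => y [].
  by apply: conv_dot_eq cx => y [].
suff H : conv A `<=` [set x | dot a x <= b /\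
    (dot a x = b -> conv (A `&` [set x | dot a x = b]) x)].
  by move=> x [/H [_ cx] /cx].
apply: conv_sub => [x y k k0 k1 [xb cx] [yb cy]|x Ax]; last first.
  by split=> [|xb]; [apply: Ab|apply: sub_conv; split].
have k1' : 0 < 1 - k by rewrite subr_gt0.
have bE : b = k * b + (1 - k) * b by rewrite -mulrDl addrC subrK mul1r.
split; first by rewrite /= dotDr !dotZr bE lerD // ler_pM2l.
rewrite dotDr !dotZr => e.
have [xe ye] : dot a x = b /\ dot a y = b.
  split; apply/eqP; rewrite eq_le ?xb ?yb /= leNgt; apply/negP => lt.
    suff : k * dot a x + (1 - k) * dot a y < b by rewrite e ltxx.
    by rewrite [ltRHS]bE ltr_leD // ?ltr_pM2l // ler_pM2l.
  suff : k * dot a x + (1 - k) * dot a y < b by rewrite e ltxx.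
  by rewrite [ltRHS]bE ler_ltD // ?ltr_pM2l // ler_pM2l.
by move/convex_setE: (@conv_convex (A `&` [set x | dot a x = b])); apply => //;
  [apply: cx|apply: cy].
Qed.

Lemma face_conv A F a b : exposes a b (conv A) F ->
  F = conv (A `&` [set x | dot a x = b]).
Proof.
move=> [le ->]; have [|_ ->] // := @conv_exposed A a b.
by move=> x /sub_conv /le.
Qed.

(** The face [set v] is the hull of the tight generators. The hull of no points is empty, so some
    generator is tight and equals [v]. *)
Lemma vertices_conv A : vertices (conv A) `<=` A.
Proof.
move=> v [a [b /face_conv e]].
have [[w Aw]|A0] := pselect (A `&` [set x | dot a x = b] !=set0); last first.
  have : conv (A `&` [set x | dot a x = b]) v by rewrite -e.
  suff: conv (A `&` [set x | dot a x = b]) `<=` set0 by move=> /[apply].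
  by apply: conv_sub => // x Ax; apply: A0; exists x.
have : [set v] w by rewrite e; apply: sub_conv.
by move=> <-; case: Aw.
Qed.

End ConvexHulls.

(** * Affine independence and dimension *)

Section Dimension.
Context {R : realType} {N : nat}.
Local Notation V := 'rV[R]_N.
Implicit Types (A : set V) (xi : V).

(** Drop the first point: a relation among the others extends by the coefficient 0. *)
Lemma has_affindepS A k : has_affindep A k.+1 -> has_affindep A k.
Proof.
move=> [x Ax ix]; exists (fun i => x (lift ord0 i)) => // c c1 c0 i.
pose c' j := oapp c 0 (unlift ord0 j).
rewrite -[c i]/(oapp c 0 (Some i)) -(liftK ord0) -/(c' _).
by apply: ix; rewrite big_ord_recl /c' unlift_none /= ?scale0r add0r;
  [rewrite -[RHS]c1|rewrite -[RHS]c0]; apply: eq_bigr => j _; rewrite liftK.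
Qed.

Lemma has_affindep_leq A k l :
  (k <= l)%N -> has_affindep A l -> has_affindep A k.
Proof.
by move=> /subnK <-; elim: (l - k)%N => //= m IH /has_affindepS.
Qed.

Lemma has_dim_inj A k l : has_dim A k -> has_dim A l -> k = l.
Proof.
move=> [k1 k2] [l1 l2]; case: (ltngtP k l) => // lt; exfalso.
- by apply: k2; apply: has_affindep_leq l1.
- by apply: l2; apply: has_affindep_leq k1.
Qed.

Lemma rows_mul_tr k (x : 'I_k -> V) a i :
  ((\matrix_i x i) *m a^T) i 0 = dot a (x i).
Proof. by rewrite mxE; apply: eq_bigr => l _; rewrite !mxE mulrC. Qed.

Lemma row_free_affindep k (x : 'I_k -> V) :
  row_free (\matrix_i x i) -> affinely_independent x.
Proof.
move=> fx c _ c0 i.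
suff /rowP/(_ i) : \row_i c i = 0 by rewrite !mxE.
apply: (row_free_inj fx); rewrite mul0mx mulmx_sum_row -[RHS]c0.
by apply: eq_bigr => j _; rewrite rowK mxE.
Qed.

(* Off the origin, affine independence is linear independence. *)
Lemma affindep_row_free xi k (x : 'I_k -> V) :
  (forall i, dot xi (x i) = 1) -> affinely_independent x ->
  row_free (\matrix_i x i).
Proof.
move=> x1 ix; apply: inj_row_free => v v0.
have e : \sum_i v 0 i *: x i = 0.
  by rewrite -[RHS]v0 mulmx_sum_row; apply: eq_bigr => i _; rewrite rowK.
apply/rowP => i; rewrite [RHS]mxE; apply: (ix (v 0)) => //.
transitivity (dot xi (\sum_i v 0 i *: x i)); last first.
  by rewrite e /dot big1 // => j _; rewrite mxE mulr0.
by rewrite dot_sumr; apply: eq_bigr => j _; rewrite dotZr x1 mulr1.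
Qed.

(** Bounds dimensions from above: at height 1 affinely independent points are linearly independent,
    and the row space of [Y] has dimension at most [p]. *)
Lemma conv_affindep_leq A xi p (Y : 'M[R]_(p, N)) k :
  (forall x, A x -> dot xi x = 1) -> (forall x, A x -> (x <= Y)%MS) ->
  has_affindep (conv A) k -> (k <= p)%N.
Proof.
move=> A1 AY [x Ax ix].
have /eqP <- : row_free (\matrix_i x i).
  by apply: (affindep_row_free (xi := xi)) => // i; apply: conv_dot_eq (Ax i).
apply: leq_trans (rank_leq_row Y); apply: mxrankS; apply/row_subP => i.
rewrite rowK; suff : conv A `<=` [set x | (x <= Y)%MS] by apply; apply: Ax.
apply: conv_sub => // y z c _ _ /= yY zY.
by rewrite addmx_sub // scalemx_sub.
Qed.

End Dimension.

(** * A chain of stackings derived from sign conditions on affine dependencies *)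

Section Stacking.
Context {R : realType} {e : nat}.
Local Notation V := 'rV[R]_e.+2.
Variables (n : nat) (xi : V) (w : nat -> V).

(** Indices below [e] stand for the set A throughout. For [i] up to [e] this lists the vertices of
    the facet spanned by A and [w m]. *)
Definition ridge_vertex (m : nat) (i : nat) := if (i < e)%N then i else m.

(** For [i] below [e.+2] this lists the simplex on A, [w j], [w k], a linear basis of the whole
    space under [w_free]. *)
Definition cell_vertex (j k : nat) (i : nat) :=
  if (i < e)%N then i else if i == e then j else k.

Hypothesis w1 : forall i, (i < n)%N -> dot xi (w i) = 1.

Hypothesis w_free : forall j k, (e <= j)%N -> (j < k)%N -> (k < n)%N ->
  row_free (\matrix_(i < e.+2) w (cell_vertex j k i)).

(** The circuit whose signs decide on which side of a hyperplane a further point lies. *)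
Hypothesis w_dep : forall i j k, (e <= i)%N -> (i < j)%N -> (j < k)%N ->
  (k < n)%N -> exists (c : nat -> R) (x y z : R),
  [/\ forall l, (l < e)%N -> 0 < c l, 0 < x, 0 < y, 0 < z &
      \sum_(l < e) c l *: w l + y *: w j = x *: w i + z *: w k].

Let P k := conv (w @` `I_k).
(** The facet of [P m.+1] onto which [w m.+1] will be stacked. *)
Let F m := conv (w @` (`I_e `|` [set m])).

Let dot_ker j k a : (e <= j)%N -> (j < k)%N -> (k < n)%N ->
  (forall l, (l < e)%N -> dot a (w l) = 0) -> dot a (w j) = 0 ->
  dot a (w k) = 0 -> a = 0.
Proof.
move=> ej jk kn al aj ak.
set M := \matrix_(i < e.+2) w (cell_vertex j k i).
have uM : M \in unitmx by rewrite -row_free_unit w_free.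
apply: trmx_inj; rewrite trmx0 -[LHS]mul1mx -(mulVmx uM) -mulmxA.
suff -> : M *m a^T = 0 by rewrite mulmx0.
apply/matrixP => i z; rewrite [RHS]mxE ord1.
have -> : (M *m a^T) i 0 = dot a (w (cell_vertex j k i)) by exact: rows_mul_tr.
by rewrite /cell_vertex; case: ifP => [/al //|_]; case: ifP.
Qed.

Let facet_functional m : (e < m)%N -> (m < n)%N -> exists a,
  [/\ forall l, (l < e)%N -> dot a (w l) = 0, dot a (w m) = 0 &
      forall j, (e <= j)%N -> (j < m)%N -> 0 < dot a (w j)].
Proof.
move=> em mn.
set M := \matrix_(i < e.+2) w (cell_vertex e m i).
have uM : M \in unitmx by rewrite -row_free_unit w_free.
(* The dual basis vector of [w e] in the basis A, [w e], [w m]. *)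
pose a : V := (invmx M *m delta_mx (inord e) 0)^T.
have aE (i : 'I_e.+2) :
    dot a (w (cell_vertex e m i)) = (i == inord e :> 'I_e.+2)%:R.
  rewrite -(rows_mul_tr (fun i : 'I_e.+2 => w (cell_vertex e m i))).
  by rewrite /a trmxK mulmxA mulmxV // mul1mx !mxE eqxx andbT.
have al l : (l < e)%N -> dot a (w l) = 0.
  move=> le; have l2 : (l < e.+2)%N by rewrite ltnS ltnW // ltnS ltnW.
  have := aE (Ordinal l2); rewrite /cell_vertex /= le => ->.
  by rewrite -val_eqE /= inordK // ltn_eqF.
have am : dot a (w m) = 0.
  have := aE ord_max; rewrite /cell_vertex /= ltnNge leqnSn /= gtn_eqF // => ->.
  by rewrite -val_eqE /= inordK // gtn_eqF.
have ae : dot a (w e) = 1.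
  by have := aE (inord e); rewrite /cell_vertex eqxx inordK // ltnn eqxx.
exists a; split=> // j; rewrite leq_eqVlt => /orP[/eqP <- _|ej jm].
  by rewrite ae.
(* Under [a] the dependency on e < j < m reduces to y a(w_j) = x. *)
have [c [x [y [z [c0 x0 y0 z0 /(congr1 (dot a))]]]]] :=
  w_dep (leqnn e) ej jm mn.
rewrite !dotDr !dotZr am ae dot_sumr big1 => [|l _]; last first.
  by rewrite dotZr al ?mulr0.
by rewrite add0r mulr0 addr0 mulr1 => yx; rewrite -(pmulr_rgt0 _ y0) yx.
Qed.

(** These points are the basis A, [w e], [w m] with position [e] deleted. *)
Let ridge_affindep m : (e < m)%N -> (m < n)%N ->
  affinely_independent (fun i : 'I_e.+1 => w (ridge_vertex m i)).
Proof.
move=> em mn c c1 c0 i.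
have /row_free_affindep ix := w_free (leqnn e) em mn.
pose z : 'I_e.+2 := inord e.
have zE : z = e :> nat by rewrite inordK.
pose c' j := oapp c 0 (unlift z j).
have E j : cell_vertex e m (lift z j) = ridge_vertex m j.
  rewrite /cell_vertex /ridge_vertex /= zE /bump.
  case: (ltnP j e) => [je|]; first by rewrite je.
  move=> ej; rewrite add1n.
  by rewrite ltnNge (leq_trans ej) //= gtn_eqF.
rewrite -[c i]/(oapp c 0 (Some i)) -(liftK z) -/(c' _).
by apply: ix; rewrite (bigD1_ord z) //= /c' unlift_none /= ?scale0r add0r;
  [rewrite -[RHS]c1|rewrite -[RHS]c0]; apply: eq_bigr => j _;
  rewrite liftK ?E.
Qed.

Let P1 k x : (k <= n)%N -> P k x -> dot xi x = 1.
Proof.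
move=> kn; apply: conv_dot_eq => _ [i /= ik <-].
by rewrite w1 // (leq_trans ik).
Qed.

Lemma chain_dim k : (e.+2 <= k <= n)%N -> has_dim (P k) e.+1.
Proof.
move=> /andP[ek kn]; split; last first.
  move=> /(conv_affindep_leq (xi := xi) (Y := 1%:M)) H.
  suff : (e.+3 <= e.+2)%N by rewrite ltnn.
  apply: H => [_ [i /= ik <-]|x _]; last exact: submx1.
  by rewrite w1 // (leq_trans ik).
exists (fun i : 'I_e.+2 => w (cell_vertex e e.+1 i)).
  move=> i; apply: sub_conv; exists (cell_vertex e e.+1 i) => //=.
  apply: leq_trans ek; rewrite /cell_vertex; case: ifP => // _.
  by case: ifP.
by apply: row_free_affindep; apply: w_free => //; apply: leq_trans kn.
Qed.

Let ridge_dim m : (e < m)%N -> (m < n)%N -> has_dim (F m) e.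
Proof.
move=> em mn; split.
  exists (fun i : 'I_e.+1 => w (ridge_vertex m i)); last exact: ridge_affindep.
  move=> i; apply: sub_conv; exists (ridge_vertex m i) => //.
  by rewrite /ridge_vertex; case: ifP => ie; [left|right].
move=> /(conv_affindep_leq (xi := xi)
          (Y := \matrix_(i < e.+1) w (ridge_vertex m i))) H.
suff : (e.+2 <= e.+1)%N by rewrite ltnn.
apply: H => _ [i /= im <-].
  by rewrite w1 //; case: im => [ie|-> //];
    rewrite (ltn_trans ie) // (ltn_trans em).
suff [j ->] : exists j : 'I_e.+1, i = ridge_vertex m j.
  by rewrite -(rowK (fun i : 'I_e.+1 => w (ridge_vertex m i)) j) row_sub.
case: im => [ie|->].
  by exists (Ordinal (leqW ie)); rewrite /ridge_vertex /= ie.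
by exists ord_max; rewrite /ridge_vertex /= ltnn.
Qed.

Let ridge_facet m : (e < m)%N -> (m < n)%N -> facet (P m.+1) (F m).
Proof.
move=> em mn; split; last first.
  by exists e; split; [apply: chain_dim; rewrite !ltnS em|apply: ridge_dim].
have [a [al am aj]] := facet_functional em mn.
have neg i x : dot (- x) (w i) = - dot x (w i).
  by rewrite -scaleN1r dotZl mulN1r.
(* [a] is nonnegative on the generators, while [exposes] asks for an upper bound. *)
exists (- a), 0.
have -> : F m = conv ((w @` `I_m.+1) `&` [set x | dot (- a) x = 0]).
  congr (conv _); apply/seteqP; split.
    move=> _ [i im <-]; split => /=.
      exists i => //=.
      by case: im => [ie|-> //]; rewrite ltnS ltnW // (ltn_trans ie).
    by rewrite neg; case: im => [/al ->|->]; rewrite ?am oppr0.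
  move=> _ [[i /= im <-]]; rewrite neg => ai0; exists i => //.
  case: (ltnP i e) => [|ei]; first by left.
  move: im; rewrite ltnS leq_eqVlt => /orP[/eqP ->|im]; first by right.
  by have := aj _ ei im; rewrite -oppr_lt0 ai0 ltxx.
apply: conv_exposed => _ [i /= im <-]; rewrite neg oppr_le0.
case: (ltnP i e) => [/al -> //|ei].
move: im; rewrite ltnS leq_eqVlt => /orP[/eqP ->|im]; first by rewrite am.
exact/ltW/aj.
Qed.

(* On the hyperplane [dot xi x = 1] the affine form [b - dot a x] is linear. *)
Let homogenize a b x : dot xi x = 1 -> dot (b *: xi - a) x = b - dot a x.
Proof. by move=> x1; rewrite dotBl dotZl x1 mulr1. Qed.

(** Were this functional zero, the inequality would be tight on the whole polytope, and G would have
    its dimension. *)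
Let facet_homogenize_neq0 m G a b : (e < m)%N -> (m < n)%N ->
  facet (P m.+1) G -> exposes a b (P m.+1) G -> b *: xi - a != 0.
Proof.
move=> em mn [_ [k [dP dG]]] [_ GE]; apply/eqP => a0.
suff GP : G = P m.+1.
  by move: dG; rewrite GP => /(has_dim_inj dP) /eqP; rewrite gtn_eqF.
rewrite GE; apply: setIidl => x Px /=; apply/esym/eqP.
rewrite -subr_eq0 -homogenize ?a0; last exact: P1 Px.
by rewrite /dot big1 // => i _; rewrite mxE mul0r.
Qed.

Let ridge_beyond m : (e < m)%N -> (m.+1 < n)%N ->
  beyond (P m.+1) (F m) (w m.+1).
Proof.
move=> em mn a b ex; have mn' := ltnW mn.
have a'0 := facet_homogenize_neq0 em mn' (ridge_facet em mn') ex.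
set a' := _ - _ in a'0.
have a'E i : (i < n)%N -> dot a' (w i) = b - dot a (w i).
  by move=> lt; rewrite homogenize ?w1.
case: ex => ge FE.
have a'F i : (i < e)%N \/ i = m -> dot a' (w i) = 0.
  move=> im; rewrite a'E; last first.
    by case: im => [ie|-> //]; rewrite (ltn_trans ie) // (ltn_trans em).
  suff : F m (w i) by rewrite FE => -[_ /= ->]; rewrite subrr.
  by apply: sub_conv; exists i.
have ae : 0 < dot a' (w e).
  (* If a' also vanished at [w e], it would vanish on a basis. *)
  rewrite lt_def; apply/andP; split.
    apply: contra a'0 => /eqP ae0; apply/eqP.
    by apply: (dot_ker (leqnn e) em mn') => // [l le|]; apply: a'F;
      [left|right].
  rewrite a'E ?(ltn_trans em) // subr_ge0; apply: ge.
  by apply: sub_conv; exists e => //=; apply: leqW.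
(* The dependency on e < m < m + 1 reduces to x a'(w_e) + z a'(w_(m+1)) = 0, so a' is negative at
   the new point. *)
have [c [x [y [z [c0 x0 y0 z0 /(congr1 (dot a'))]]]]] :=
  w_dep (leqnn e) em (leqnn m.+1) mn.
rewrite !dotDr !dotZr (a'F m) ?mulr0; last by right.
rewrite dot_sumr big1 => [|l _]; last by rewrite dotZr a'F ?mulr0 //; left.
rewrite addr0 => /esym/eqP; rewrite addrC addr_eq0 => /eqP zE.
rewrite -subr_lt0 -a'E // -(pmulr_rlt0 _ z0) zE oppr_lt0.
exact: mulr_gt0.
Qed.

Let other_beneath m G : (e < m)%N -> (m.+1 < n)%N ->
  facet (P m.+1) G -> G <> F m -> beneath (P m.+1) G (w m.+1).
Proof.
move=> em mn fG GF a b ex; have mn' := ltnW mn.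
have a'0 := facet_homogenize_neq0 em mn' fG ex.
set a' := _ - _ in a'0.
have a'E i : (i < n)%N -> dot a' (w i) = b - dot a (w i).
  by move=> lt; rewrite homogenize ?w1.
have GE := face_conv ex.
case: (ex) => ge _.
have a'ge i : (i < m.+1)%N -> 0 <= dot a' (w i).
  move=> im; rewrite a'E ?(leq_trans im) // subr_ge0; apply: ge.
  by apply: sub_conv; exists i.
have [[j [ej jm aj]]|noj] :=
  pselect (exists j, [/\ (e <= j)%N, (j < m)%N & dot a' (w j) = 0]).
  (* The dependency on j < m < m + 1 writes z a'(w_(m+1)) as a sum of nonnegative terms; if all were
     zero, a' would vanish on the basis A, [w j], [w m]. *)
  have [c [x [y [z [c0 x0 y0 z0 /(congr1 (dot a'))]]]]] :=
    w_dep ej jm (leqnn m.+1) mn.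
  rewrite !dotDr !dotZr aj mulr0 add0r dot_sumr => zE.
  have cge (l : 'I_e) : 0 <= dot a' (c l *: w l).
    rewrite dotZr mulr_ge0 //; first by rewrite ltW ?c0.
    by apply: a'ge; rewrite ltnS ltnW // (ltn_trans (ltn_ord l)).
  have sge : 0 <= \sum_(l < e) dot a' (c l *: w l).
    by apply: sumr_ge0 => l _; exact: cge.
  have yge : 0 <= y * dot a' (w m) by rewrite mulr_ge0 ?a'ge // ltW.
  rewrite -subr_gt0 -a'E // -(pmulr_rgt0 _ z0) -zE lt_def addr_ge0 // andbT.
  apply: contra a'0; rewrite paddr_eq0 // => /andP[s0 m0]; apply/eqP.
  apply: (dot_ker ej jm mn') => //.
    move=> l le; have := s0; rewrite psumr_eq0 // => /allP /(_ (Ordinal le)).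
    rewrite mem_index_enum /= dotZr mulf_eq0 (gt_eqF (c0 _ le)) /=.
    by move=> /(_ isT) /eqP.
  by apply/eqP; move: m0; rewrite mulf_eq0 (gt_eqF y0).
(* Only A and [w m] can now be tight. If all of them are, G is [F m]; if one is not, G lies in the
   span of e points and is too small for a facet. *)
exfalso.
have sub i : (i < m.+1)%N -> dot a' (w i) = 0 ->
    exists i' : 'I_e.+1, i = ridge_vertex m i'.
  move=> im ai; case: (ltnP i e) => [ie|ei].
    by exists (Ordinal (leqW ie)); rewrite /ridge_vertex /= ie.
  have -> : i = m.
    move: im; rewrite ltnS leq_eqVlt => /orP[/eqP //|im].
    by case: noj; exists i.
  by exists ord_max; rewrite /ridge_vertex /= ltnn.
have ridge_lt (i : 'I_e.+1) : (ridge_vertex m i < m.+1)%N.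
  rewrite /ridge_vertex; case: ifP => // ie.
  by rewrite ltnS ltnW // (ltn_trans ie).
have [all0|/existsNP [i0 i0P]] :=
  pselect (forall i : 'I_e.+1, dot a' (w (ridge_vertex m i)) = 0).
  apply: GF; rewrite GE; congr (conv _); apply/seteqP; split.
    move=> _ [[i /= im <-]] aib.
    have [|i' iE] := sub i im; first by rewrite a'E ?aib ?subrr ?(leq_trans im).
    by exists i => //; rewrite iE /ridge_vertex; case: ifP; [left|right].
  move=> _ [i /= im <-].
  have [i' iE] : exists i' : 'I_e.+1, i = ridge_vertex m i'.
    case: im => [ie|->].
      by exists (Ordinal (leqW ie)); rewrite /ridge_vertex /= ie.
    by exists ord_max; rewrite /ridge_vertex /= ltnn.
  split; first by exists i => //=; rewrite iE.
  apply/esym/eqP; rewrite -subr_eq0 -a'E ?iE ?all0 //.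
  exact: leq_trans (ridge_lt _) mn'.
case: fG => _ [k [dP dG]].
have [ke] : k.+1 = e.+1.
  by apply: has_dim_inj dP _; apply: chain_dim; rewrite !ltnS em.
move: dG => [+ _]; rewrite ke GE => /(conv_affindep_leq (xi := xi)
    (Y := \matrix_(i < e) w (ridge_vertex m (lift i0 i)))) H.
suff : (e.+1 <= e)%N by rewrite ltnn.
apply: H => _ [[i /= im <-] aib]; first by rewrite w1 // (leq_trans im).
have ai : dot a' (w i) = 0 by rewrite a'E ?aib ?subrr ?(leq_trans im).
have [i' iE] := sub i im ai.
case: (unliftP i0 i') => [i'' i'E|i'E]; last by case: i0P; rewrite -i'E -iE.
rewrite iE i'E.
by rewrite -(rowK (fun i : 'I_e => w (ridge_vertex m (lift i0 i))) i'') row_sub.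
Qed.

(** Coordinates in the basis of the first e + 2 points are affine: all points have height 1, so the
    coordinates sum to 1. *)
Let aff_chain m : (e < m)%N -> (m.+1 < n)%N -> aff (P m.+1) (w m.+1).
Proof.
move=> em mn; have en : (e.+1 < n)%N by apply: leq_trans mn; rewrite !ltnS ltnW.
set M := \matrix_(i < e.+2) w (cell_vertex e e.+1 i).
have uM : M \in unitmx by rewrite -row_free_unit w_free.
pose c := w m.+1 *m invmx M.
have cE : w m.+1 = \sum_i c 0 i *: w (cell_vertex e e.+1 i).
  transitivity (c *m M); first by rewrite mulmxKV.
  by rewrite mulmx_sum_row; apply: eq_bigr => i _; rewrite rowK.
have lt (i : 'I_e.+2) : (cell_vertex e e.+1 i < e.+2)%N.
  by rewrite /cell_vertex; case: ifP => // _; case: ifP.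
exists e.+2, (fun i => w (cell_vertex e e.+1 i)), (c 0); split=> //.
  move=> i; apply: sub_conv; exists (cell_vertex e e.+1 i) => //=.
  exact: leq_trans (lt i) _.
rewrite -(w1 mn) [in RHS]cE dot_sumr; apply: eq_bigr => i _.
by rewrite dotZr w1 ?mulr1 // (leq_trans (lt i)).
Qed.

Lemma chain_stacking m : (e < m)%N -> (m.+1 < n)%N ->
  stacking (P m.+1) (F m) (w m.+1).
Proof.
move=> em mn; split.
- exact/ridge_facet/ltnW.
- exact: aff_chain.
- exact: ridge_beyond.
- by move=> G; apply: other_beneath.
Qed.

Lemma chain_stacked k : (e.+2 <= k <= n)%N -> stacked e.+1 (P k).
Proof.
elim: k => // k IH /andP[]; rewrite leq_eqVlt => /orP[/eqP [<-] en|ek kn].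
  apply: stacked_simplex; exists (fun i : 'I_e.+2 => w (cell_vertex e e.+1 i)).
    exact/row_free_affindep/w_free.
  congr (conv _); apply/seteqP; split.
    move=> _ [i /= ie <-]; exists (Ordinal ie) => //=; congr (w _).
    rewrite /cell_vertex; case: ltnP => // ei; case: (eqVneq i e) => // ie'.
    by apply/eqP; rewrite eqn_leq ltn_neqAle eq_sym ie' ei /= -ltnS.
  move=> _ [i _ <-]; exists (cell_vertex e e.+1 i) => //=.
  by rewrite /cell_vertex; case: ifP => // _; case: ifP.
rewrite ltnS in ek; case: k => // m in IH ek kn *.
have -> : P m.+2 = conv (P m.+1 `|` [set w m.+1]).
  rewrite conv_setU_conv; congr (conv _); apply/seteqP; split.
    move=> _ [i /= + <-]; rewrite ltnS leq_eqVlt.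
    move=> /orP[/eqP ->|im]; first by right.
    by left; exists i.
  by move=> _ [[i /= im <-]|->];
    [exists i => //=; apply: leqW|exists m.+1 => /=].
apply: stacked_stacking (chain_stacking _ _); last by [].
- by apply: IH; rewrite ek ltnW.
- by [].
Qed.

End Stacking.

(** * Divided differences and points on the moment curve *)

Section DividedDifferences.
Context {R : realType}.
Implicit Types (p : {poly R}) (t : R).

Lemma poly_roots_eq0 m (x : 'I_m -> R) p :
  injective x -> (size p <= m)%N -> (forall i, p.[x i] = 0) -> p = 0.
Proof.
move=> xI sp px; apply/eqP; apply: contraTT sp => p0; rewrite -ltnNge.
have := @max_poly_roots _ p (codom x) p0.
rewrite size_codom card_ord; apply; last by apply/injectiveP.
by apply/allP => _ /codomP [i ->]; apply/rootP.
Qed.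

(** The numerator of the i-th Lagrange basis polynomial; [lift i] skips the index [i]. *)
Definition node_poly m (x : 'I_m.+1 -> R) (i : 'I_m.+1) : {poly R} :=
  \prod_(j < m) ('X - (x (lift i j))%:P).

Lemma horner_node_poly m (x : 'I_m.+1 -> R) (i : 'I_m.+1) t :
  (node_poly x i).[t] = \prod_(j < m) (t - x (lift i j)).
Proof. by rewrite horner_prod; apply: eq_bigr => j _; rewrite hornerXsubC. Qed.

Lemma node_poly_neq0 m (x : 'I_m.+1 -> R) (i : 'I_m.+1) :
  injective x -> (node_poly x i).[x i] != 0.
Proof.
move=> xI; rewrite horner_node_poly; apply/prodf_neq0 => j _.
by rewrite subr_eq0; apply/eqP => /xI /eqP; rewrite (negPf (neq_lift _ _)).
Qed.

Lemma node_poly_eq0 m (x : 'I_m.+1 -> R) i k :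
  k != i -> (node_poly x i).[x k] = 0.
Proof.
move=> ki; rewrite horner_node_poly.
by case: (unliftP i k) ki => [j ->|->];
  rewrite ?eqxx // (bigD1 j) //= subrr mul0r.
Qed.

Lemma size_node_poly m (x : 'I_m.+1 -> R) (i : 'I_m.+1) :
  size (node_poly x i) = m.+1.
Proof. by rewrite size_prod_XsubC /index_enum -enumT size_enum_ord. Qed.

(** [p] equals its Lagrange interpolant [g]. The node polynomials are monic of degree m, so the sum
    is the coefficient of X^m in [g], which is 0 because [p] has smaller degree. *)
Lemma divided_difference m (x : 'I_m.+1 -> R) p :
  injective x -> (size p <= m)%N ->
  \sum_i p.[x i] / (node_poly x i).[x i] = 0.
Proof.
move=> xI sp.
pose g := \sum_i (p.[x i] / (node_poly x i).[x i]) *: node_poly x i.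
have /eqP : p - g = 0.
  apply: (poly_roots_eq0 xI) => [|k].
    apply: (leq_trans (size_polyD _ _)).
    rewrite size_polyN geq_max (leqW sp) /=.
    apply: (leq_trans (size_sum _ _ _)); apply/bigmax_leqP => i _.
    by rewrite (leq_trans (size_scale_leq _ _)) // size_node_poly.
  rewrite hornerD hornerN horner_sum (bigD1 k) //= big1 ?addr0 => [|i ik].
    by rewrite hornerZ mulfVK ?subrr // node_poly_neq0.
  by rewrite hornerZ (@node_poly_eq0 _ _ i k) ?mulr0 // eq_sym.
rewrite subr_eq0 => /eqP /(congr1 (coefp m)); rewrite /= nth_default //.
rewrite coef_sum => /esym e; rewrite -[RHS]e; apply: eq_bigr => i _.
have /monicP :=
  monic_prod_XsubC (index_enum 'I_m) predT (fun j => x (lift i j)).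
rewrite -/(node_poly x i) lead_coefE size_node_poly /= coefZ => ->.
by rewrite mulr1.
Qed.

(** Coordinate k is the divided difference of X^k, where k <= d. *)
Lemma veronese_dependency d (x : 'I_d.+2 -> R) : injective x ->
  \sum_i ((node_poly x i).[x i])^-1 *: veronese d (x i) = 0.
Proof.
move=> xI; apply/rowP => k; rewrite summxE [RHS]mxE.
rewrite -[RHS](@divided_difference _ x 'X^k xI); last by rewrite size_polyXn.
by apply: eq_bigr => i _; rewrite !mxE hornerXn mulrC.
Qed.

Lemma dot_veronese d p t : (size p <= d.+1)%N ->
  dot (\row_(i < d.+1) p`_i) (veronese d t) = p.[t].
Proof.
move=> sp; rewrite (horner_coef_wide _ sp).
by apply: eq_bigr => i _; rewrite !mxE.
Qed.

Lemma dot_veroneseE d (xi : 'rV[R]_d.+1) t : dot xi (veronese d t) = q xi t.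
Proof. by apply: eq_bigr => i _; rewrite mxE. Qed.

(** Pairing a vanishing combination with the coefficients of the i-th node polynomial leaves only
    its i-th term. *)
Lemma row_free_veronese d (x c : 'I_d.+1 -> R) :
  injective x -> (forall i, c i != 0) ->
  row_free (\matrix_i (c i *: veronese d (x i))).
Proof.
move=> xI c0; apply: inj_row_free => v v0; apply/rowP => i; rewrite [RHS]mxE.
have s : (size (node_poly x i) <= d.+1)%N by rewrite size_node_poly.
pose a := \row_(k < d.+1) (node_poly x i)`_k.
have : (v *m (\matrix_i (c i *: veronese d (x i))) *m a^T) 0 0 = 0.
  by rewrite v0 mul0mx mxE.
rewrite -mulmxA mxE (bigD1 i) //= big1 => [|j ji].
  rewrite rows_mul_tr dotZr dot_veronese // addr0 => /eqP.
  rewrite !mulf_eq0 (negPf (c0 i)) (negPf (node_poly_neq0 _ xI)) !orbF.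
  by move=> /eqP.
by rewrite rows_mul_tr dotZr dot_veronese // node_poly_eq0 ?mulr0.
Qed.

(** [K - i] counts the negative factors; truncated subtraction covers [i] beyond [K]. *)
Lemma sgr_prod_switch (f : nat -> R) K i :
  (forall j, (j < K)%N -> (j < i)%N -> 0 < f j) ->
  (forall j, (j < K)%N -> (i <= j)%N -> f j < 0) ->
  Num.sg (\prod_(j < K) f j) = (-1) ^+ (K - i).
Proof.
elim: K => [|K IH] fp fn; first by rewrite big_ord0 sgr1 expr0.
rewrite big_ord_recr /= sgrM IH => [|j jK|j jK]; last 2 first.
- exact/fp/leqW.
- exact/fn/leqW.
case: (ltnP K i) => Ki.
  by rewrite gtr0_sg ?fp // mulr1 (eqP Ki) (eqP (ltnW Ki)).
by rewrite ltr0_sg ?fn // subSn // exprSr.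
Qed.

End DividedDifferences.

(** * Veronese points whose signs alternate on the first blocks *)

Section AlternatingSigns.
Context {R : realType} {r : nat}.
Variables (n : nat) (xi : 'rV[R]_r.+4) (u : nat -> R) (s : R).

Hypothesis rn : (r.+4 <= n)%N.
Hypothesis u_incr : forall i j, (i < j)%N -> (j < n)%N -> u i < u j.
Hypothesis s_neq0 : s != 0.
Hypothesis s_sg : Num.sg s = s.
(** Here d = r + 3 and e = r + 2. There are [r] singleton blocks, so [minn i r] is the index of the
    block of [u i]. *)
Hypothesis q_sign : forall i, (i < n)%N ->
  Num.sg (q xi (u i)) = s * (-1) ^+ minn i r.

Let v i := (q xi (u i))^-1 *: veronese r.+3 (u i).

(* The position in [T] of the i-th vertex of the stacking order: the singleton
   blocks, the first and the last point of the long block, and then its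
   remaining points in increasing order. *)
Definition stacking_order i : nat :=
  if (i < r.+1)%N then i else if i == r.+1 then n.-1 else i.-1.

Let w i := v (stacking_order i).

Lemma u_inj i j : (i < n)%N -> (j < n)%N -> u i = u j -> i = j.
Proof.
move=> im jn uij; case: (ltngtP i j) => // lt.
- by have := u_incr lt jn; rewrite uij ltxx.
- by have := u_incr lt im; rewrite uij ltxx.
Qed.

Let s_sqr : s * s = 1.
Proof. by rewrite -[in LHS]s_sg -expr2 sqr_sg s_neq0. Qed.

Let q_neq0 i : (i < n)%N -> q xi (u i) != 0.
Proof.
by move=> im; rewrite -sgr_eq0 q_sign // mulf_eq0 (negPf s_neq0) signr_eq0.
Qed.

Lemma stacking_order_lt i : (i < n)%N -> (stacking_order i < n)%N.
Proof. by rewrite /stacking_order => im; do 2 (case: ifP => ?; try lia). Qed.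

Lemma stacking_order_inj i j : (i < n)%N -> (j < n)%N ->
  stacking_order i = stacking_order j -> i = j.
Proof.
by rewrite /stacking_order => im jn; do 4 (case: ifP => ?; try lia).
Qed.

Lemma stacking_order_image : w @` `I_n = v @` `I_n.
Proof.
apply/seteqP; split=> _ [i /= im <-].
  by exists (stacking_order i) => //=; apply: stacking_order_lt.
(* The inverse of [stacking_order]. *)
pose k := if (i < r.+1)%N then i else if i == n.-1 then r.+1 else i.+1.
exists k; first by rewrite /k /=; do 2 (case: ifP => ?; try lia).
congr v; rewrite /k; case: (ltnP i r.+1) => ?.
  by rewrite /stacking_order; do 2 (case: ifP => ?; try lia).
by case: eqP => ?; rewrite /stacking_order; do 2 (case: ifP => ?; try lia).
Qed.

Lemma v_height i : (i < n)%N -> dot xi (v i) = 1.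
Proof. by move=> im; rewrite dotZr dot_veroneseE mulVf // q_neq0. Qed.

Lemma cell_free j k : (r.+2 <= j)%N -> (j < k)%N -> (k < n)%N ->
  row_free (\matrix_(i < r.+4) w (cell_vertex (e := r.+2) j k i)).
Proof.
move=> ej jk kn.
have lt (i : 'I_r.+4) : (cell_vertex (e := r.+2) j k i < n)%N.
  by rewrite /cell_vertex; do 2 (case: ifP => ?; try lia).
apply: row_free_veronese => [i1 i2|i]; last first.
  by rewrite invr_eq0 q_neq0 // stacking_order_lt.
move=> /(u_inj (stacking_order_lt (lt _)) (stacking_order_lt (lt _))).
move=> /(stacking_order_inj (lt _) (lt _)) e12; apply/val_inj => /=.
by move: e12; rewrite /cell_vertex; case: i1 i2 => [i1 ?] [i2 ?] /=;
  do 4 (case: ifP => ?; try lia).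
Qed.

(** The positions in T, in increasing order, of A and the points number [i], [j], [k] of the
    stacking order. Indices from r + 2 on shift down by one since the last point of T was taken
    early. *)
Let circuit i j k m : nat := if (m < r.+1)%N then m else
  if m == r.+1 then i.-1 else if m == r.+2 then j.-1 else
  if m == r.+3 then k.-1 else n.-1.

(* In the affine dependency of d + 2 points on the moment curve the signs
   alternate; multiplying by the signs of [q xi] turns the alternation on the
   singleton blocks into a constant sign. *)
Lemma circuit_dependency i j k :
  (r.+2 <= i)%N -> (i < j)%N -> (j < k)%N -> (k < n)%N ->
  exists (c : nat -> R) (x y z : R),
  [/\ forall l, (l < r.+2)%N -> 0 < c l, 0 < x, 0 < y, 0 < z &
      \sum_(l < r.+2) c l *: w l + y *: w j = x *: w i + z *: w k].
Proof.
move=> ei ij jk kn.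
pose U m := u (circuit i j k m).
have circuit_lt m : (circuit i j k m < n)%N.
  by rewrite /circuit; do 4 (case: ifP => ?; try lia).
have U_incr a b : (a < b)%N -> (b < r.+4.+1)%N -> U a < U b.
  by move=> ab bm; apply: u_incr => //; rewrite /circuit;
    do 8 (case: ifP => ?; try lia).
have UI : injective (fun a : 'I_r.+4.+1 => U a).
  move=> a b e; apply/val_inj; case: (ltngtP a b) => //= lt.
  - by have := U_incr _ _ lt (ltn_ord b); rewrite e ltxx.
  - by have := U_incr _ _ lt (ltn_ord a); rewrite e ltxx.
pose D (a : 'I_r.+4.+1) := (node_poly (fun b : 'I_r.+4.+1 => U b) a).[U a].
(* [s * (-1) ^+ r] is the sign of q on the long block; this factor makes the coefficients on A
   positive. *)
pose mu (a : nat) := s * (-1) ^+ r * (q xi (U a) / D (inord a)).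
(* Each node above [U a] contributes one negative factor. *)
have sgD a : (a < r.+4.+1)%N -> Num.sg (D (inord a)) = (-1) ^+ (r.+4 - a).
  move=> am; rewrite /D horner_node_poly inordK //.
  transitivity (Num.sg (\prod_(b < r.+4) (U a - U (bump a b)))).
    by congr Num.sg; apply: eq_bigr => b _; rewrite /= inordK.
  rewrite (@sgr_prod_switch _ (fun b => U a - U (bump a b)) _ a) //.
    move=> b bm ba; rewrite subr_gt0; apply: U_incr => //.
    by rewrite /bump; case: leqP => ?; lia.
  by move=> b bm ab; rewrite subr_lt0; apply: U_incr; rewrite /bump ab.
have sgmu a : (a < r.+4.+1)%N ->
    Num.sg (mu a) = (-1) ^+ (r + (minn (circuit i j k a) r + (r.+4 - a))).
  move=> am; rewrite /mu !sgrM sgrV sgD // q_sign // sgrX sgrN1.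
  by rewrite s_sg !exprD mulrACA [s * _ * _]mulrC; ring: s_sqr.
have mu_sum : \sum_(a < r.+4.+1) mu a *: v (circuit i j k a) = 0.
  transitivity ((s * (-1) ^+ r) *:
      \sum_(a < r.+4.+1) (D a)^-1 *: veronese r.+3 (U a)).
    rewrite scaler_sumr; apply: eq_bigr => a _.
    rewrite /v /mu inord_val -/(U a) !scalerA; congr (_ *: _).
    by rewrite -!mulrA; congr (_ * (_ * _)); rewrite mulrC mulfVK // q_neq0.
  by rewrite (veronese_dependency (d := r.+3) UI) scaler0.
have mu_pos a m : (a < r.+4.+1)%N ->
    (r + (minn (circuit i j k a) r + (r.+4 - a)) = m.*2)%N -> 0 < mu a.
  by move=> am e; rewrite -sgr_gt0 sgmu // e -signr_odd odd_double ltr01.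
have mu_neg a m : (a < r.+4.+1)%N ->
    (r + (minn (circuit i j k a) r + (r.+4 - a)) = m.*2.+1)%N -> 0 < - mu a.
  move=> am e; rewrite oppr_gt0 -sgr_lt0 sgmu // e -signr_odd /= odd_double.
  exact: ltrN10.
(* A occupies the circuit positions 0, ..., r and r + 4; the latter is the last point of T, which is
   [w r.+1]. *)
have cE l : (l < r.+2)%N ->
    v (circuit i j k (if (l < r.+1)%N then l else r.+4)) = w l.
  move=> lr; congr v; rewrite /circuit /stacking_order.
  by case: (ltnP l r.+1) => [->//|?]; do 5 (case: ifP => ?; try lia).
exists (fun l => mu (if (l < r.+1)%N then l else r.+4)).
exists (- mu r.+1), (mu r.+2), (- mu r.+3); split.
- move=> l lr; case: (ltnP l r.+1) => [lr'|_].
    apply: (mu_pos _ r.+2); first lia.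
    by rewrite /circuit lr'; lia.
  apply: (mu_pos _ r) => //.
  by rewrite /circuit; do 4 (case: ifP => ?; try lia).
- apply: (mu_neg _ r.+1); first lia.
  by rewrite /circuit; do 4 (case: ifP => ?; try lia).
- apply: (mu_pos _ r.+1); first lia.
  by rewrite /circuit; do 4 (case: ifP => ?; try lia).
- apply: (mu_neg _ r); first lia.
  by rewrite /circuit; do 4 (case: ifP => ?; try lia).
move: mu_sum; rewrite !big_ord_recr /= => e.
have vE l : (l < r.+1)%N -> v (circuit i j k l) = w l.
  by move=> lr; have := cE l (leqW lr); rewrite lr.
have v1 : v (circuit i j k r.+1) = w i.
  by congr v; rewrite /circuit /stacking_order; do 4 (case: ifP => ?; try lia).
have v2 : v (circuit i j k r.+2) = w j.
  by congr v; rewrite /circuit /stacking_order; do 5 (case: ifP => ?; try lia).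
have v3 : v (circuit i j k r.+3) = w k.
  by congr v; rewrite /circuit /stacking_order; do 6 (case: ifP => ?; try lia).
have v4 : v (circuit i j k r.+4) = w r.+1.
  by congr v; rewrite /circuit /stacking_order; do 6 (case: ifP => ?; try lia).
rewrite v1 v2 v3 v4 vE // in e; rewrite ltnSn ltnn.
have -> : \sum_(l < r) mu (if (l < r.+1)%N then nat_of_ord l else r.+4) *: w l =
    \sum_(l < r) mu l *: v (circuit i j k l).
  by apply: eq_bigr => l _; rewrite (leqW (ltn_ord l)) vE // leqW.
apply/eqP; rewrite -subr_eq0 -[X in _ == X]e; apply/eqP.
rewrite !scaleNr opprD !opprK !addrA.
by rewrite [LHS](ACl (1*2*5*4*6*3)).
Qed.

(** * Supporting hyperplanes at the single points *)

Let midpoint l := (u l + u l.+1) / 2.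

(** The sign of q switches from u_l to u_(l+1) exactly for l < r. The midpoints reproduce these
    switches, the scalar matches the sign on the long block, and the square adds a zero at u_i while
    keeping all other signs. *)
Let support i : {poly R} :=
  (s * (-1) ^+ r) *:
  (\prod_(l < r) ('X - (midpoint l)%:P) * ('X - (u i)%:P) ^+ 2).

Let size_support i : (size (support i) <= r.+4)%N.
Proof.
apply: leq_trans (size_scale_leq _ _) _.
apply: leq_trans (size_polyMleq _ _) _.
rewrite size_prod_XsubC size_exp_XsubC /index_enum -enumT size_enum_ord.
by rewrite addSn addnC.
Qed.

Let support_self i : (support i).[u i] = 0.
Proof.
by rewrite hornerZ hornerM horner_exp hornerXsubC subrr expr0n mulr0 mulr0.
Qed.

Let support_gt0 i m : (i < n)%N -> (m < n)%N -> i != m ->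
  0 < (support i).[u m] / q xi (u m).
Proof.
move=> im mn neq; rewrite -sgr_gt0 sgrM sgrV q_sign //.
rewrite hornerZ hornerM horner_exp hornerXsubC.
have X0 : 0 < (u m - u i) ^+ 2.
  rewrite exprn_even_gt0 //= subr_eq0.
  by apply: contra_neq neq => /(u_inj mn im).
move: (_ ^+ 2) X0 => X X0; rewrite !sgrM (gtr0_sg X0) s_sg sgrX sgrN1 mulr1.
(* The midpoints to the right of u_m are those with index at least m. *)
have -> : Num.sg (\prod_(l < r) ('X - (midpoint l)%:P)).[u m] =
    (-1) ^+ (r - m).
  rewrite horner_prod; under eq_bigr => l _ do rewrite hornerXsubC.
  apply: (@sgr_prod_switch _ (fun l => u m - midpoint l)) => l lr lm.
  - have u1 : u l < u l.+1 by apply: u_incr; lia.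
    have u2 : u l.+1 <= u m.
      by move: lm; rewrite leq_eqVlt => /orP[/eqP <- //|lm]; apply/ltW/u_incr.
    by rewrite subr_gt0 ltr_pdivrMr //; lra.
  - have u1 : u l < u l.+1 by apply: u_incr; lia.
    have u2 : u m <= u l.
      move: lm; rewrite leq_eqVlt => /orP[/eqP -> //|lm]; apply/ltW/u_incr; lia.
    by rewrite subr_lt0 ltr_pdivlMr //; lra.
have -> : s * (-1) ^+ r * (-1) ^+ (r - m) * (s * (-1) ^+ minn m r) =
    s * s * (-1) ^+ (r + (r - m + minn m r)) by rewrite !exprD; ring.
rewrite s_sqr mul1r -signr_odd; case: (leqP m r) => ?.
  by rewrite subnK // oddD addbb ltr01.
by rewrite (_ : r - m = 0)%N ?add0n ?oddD ?addbb ?ltr01 //; lia.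
Qed.

Lemma v_vertex i : (i < n)%N -> vertices (conv (v @` `I_n)) (v i).
Proof.
move=> im; pose p := - support i.
have sp : (size p <= r.+4)%N by rewrite size_polyN.
pose a := \row_(k < r.+4) p`_k.
have aE m : dot a (v m) = - ((support i).[u m] / q xi (u m)).
  by rewrite dotZr dot_veronese // hornerN mulrN mulrC.
have av : dot a (v i) = 0 by rewrite aE support_self mul0r oppr0.
have neg m : (m < n)%N -> m != i -> dot a (v m) < 0.
  by move=> mn mi; rewrite aE oppr_lt0 support_gt0 // eq_sym.
exists a, 0; rewrite -[X in exposes _ _ _ X]conv_set1.
have -> : [set v i] = (v @` `I_n) `&` [set x | dot a x = 0].
  apply/seteqP; split=> [_ ->|_ [[m /= mn <-]] am].
    by split => //; exists i.
  have [-> //|/(neg _ mn)] := eqVneq m i.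
  by rewrite am ltxx.
apply: conv_exposed => _ [m /= mn <-].
by have [->|/(neg _ mn)/ltW //] := eqVneq m i; rewrite av.
Qed.

(** The functional supporting at [v i] vanishes there but not at any [v j] with another index. *)
Lemma v_inj i j : (i < n)%N -> (j < n)%N -> v i = v j -> i = j.
Proof.
move=> im jn vij; apply/eqP; apply: contraTT isT => ij.
pose a := \row_(k < r.+4) (support i)`_k.
have : dot a (v j) != 0.
  by rewrite dotZr dot_veronese // mulrC gt_eqF // support_gt0.
by rewrite -vij dotZr dot_veronese // support_self mulr0 eqxx.
Qed.

Lemma alternating_stacked :
  [/\ has_dim (conv (v @` `I_n)) r.+3, stacked r.+3 (conv (v @` `I_n)) &
      vertices (conv (v @` `I_n)) #= `I_n].
Proof.
have w1 i : (i < n)%N -> dot xi (w i) = 1.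
  by move=> im; apply/v_height/stacking_order_lt.
split.
- rewrite -stacking_order_image.
  by apply: (chain_dim w1 cell_free); rewrite rn leqnn.
- rewrite -stacking_order_image.
  by apply: (chain_stacked w1 cell_free circuit_dependency); rewrite rn leqnn.
- have -> : vertices (conv (v @` `I_n)) = v @` `I_n.
    apply/seteqP; split; first exact: vertices_conv.
    by move=> _ [i im <-]; apply: v_vertex.
  apply: inj_card_eq => i j; rewrite !inE; exact: v_inj.
Qed.

End AlternatingSigns.

(** * Signs of q on a chamber and in its interior *)

Section Chambers.
Context {R : realType} {d : nat}.
Implicit Types (xi eta : 'rV[R]_d.+1) (T : set R).

Lemma q_continuous t : continuous (fun eta : 'rV[R]_d.+1 => q eta t).
Proof.
rewrite /q; apply: continuous_big => [|i _]; first exact: add_continuous.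
move=> eta; apply: (@cvgMr_tmp _ _ _ _ (fun eta : 'rV[R]_d.+1 => eta 0 i)).
  exact: (@nbhs_filter _ eta).
exact: (@coord_continuous R 1 d.+1 0 i).
Qed.

Lemma q_perturb xi h t : q (xi + h *: delta_mx 0 0) t = q xi t + h.
Proof.
rewrite -!dot_veroneseE /dot; under eq_bigr => i _ do rewrite !mxE mulrDl.
rewrite big_split /=; congr (_ + _).
  by apply: eq_bigr => i _; rewrite mxE.
rewrite (bigD1 ord0) //= big1 => [|i i0]; last first.
  by rewrite (negPf i0) mulr0 mul0r.
by rewrite /= mulr1 addr0 mulr1.
Qed.

(** On the component, the values of q at t form an interval that avoids 0; the resulting weak sign
    passes to the closure. *)
Lemma chamber_sign T sigma t : chamber T sigma -> T t ->
  (forall eta, sigma eta -> 0 <= q eta t) \/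
  (forall eta, sigma eta -> q eta t <= 0).
Proof.
move=> [xi0 _ ->] Tt; set C := connected_component _ _.
have CI : is_interval [set q eta t | eta in C].
  apply/connected_intervalP/connected_continuous_connected.
    exact: component_connected.
  by apply: continuous_subspaceT; exact: q_continuous.
have C0 eta : C eta -> q eta t != 0.
  by move=> [D [_ DA _] De]; apply: (DA _ De).
have [[eta Ce e0]|no] := pselect (exists2 eta, C eta & q eta t < 0).
  right=> eta' Ce'; have : closure [set eta | q eta t <= 0] eta'.
    apply: closureS Ce' => z Cz /=; rewrite leNgt; apply/negP => z0.
    have [y Cy] : [set q eta t | eta in C] 0.
      apply: (CI (q eta t) (q z t)); [by exists eta|by exists z|].
      by rewrite !ltW.
    by move/eqP; apply/negP/C0.
  rewrite -(closure_id _).1 //.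
  exact: ((continuous_closedP _).1 (@q_continuous t) _ (@closed_le _ 0)).
left=> eta' Ce'; have : closure [set eta | 0 <= q eta t] eta'.
  apply: closureS Ce' => z Cz /=; rewrite leNgt; apply/negP => z0.
  by apply: no; exists z.
rewrite -(closure_id _).1 //.
exact: ((continuous_closedP _).1 (@q_continuous t) _ (@closed_ge _ 0)).
Qed.

(** If q vanished at t, small changes of the constant coefficient in both directions would stay in
    sigma and give values of both signs. *)
Lemma interior_chamber_neq0 T sigma xi t : chamber T sigma ->
  interior sigma xi -> T t -> q xi t != 0.
Proof.
move=> ch ixi Tt; apply/eqP => q0.
have : \forall h \near (0 : R), sigma (xi + h *: delta_mx 0 0).
  have : (fun h : R => xi + h *: delta_mx 0 0) h @[h --> (0 : R)] --> xi.
    have {2}-> : xi = xi + 0 *: delta_mx 0 0 by rewrite scale0r addr0.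
    by apply: cvgD; [exact: cvg_cst|exact: scalel_continuous].
  by apply.
move=> /nbhs_ballP [e /= e0 He].
have sig h : `|h| < e -> sigma (xi + h *: delta_mx 0 0).
  by move=> he; apply: He; rewrite /ball /= sub0r normrN.
have e2 : `|e / 2| < e by rewrite gtr0_norm; lra.
have e2' : `|- (e / 2)| < e by rewrite normrN.
by case: (chamber_sign ch Tt) => H;
  have := H _ (sig _ e2); have := H _ (sig _ e2');
  rewrite !q_perturb q0; lra.
Qed.

End Chambers.

(** * From the signed decomposition to an increasing list with known signs *)

Section Enumeration.
Context {R : realType}.
Implicit Types (A T : set R).

Lemma increasing_enumeration A m : A #= `I_m -> exists u : nat -> R,
  A = u @` `I_m /\ forall i j, (i < j)%N -> (j < m)%N -> u i < u j.
Proof.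
rewrite card_eq_sym => /card_set_bijP [f [fA fI fS]].
pose L := sort <=%O [seq f i | i <- iota 0 m].
have sL : size L = m by rewrite size_sort size_map size_iota.
have memL x : x \in L <-> A x.
  rewrite mem_sort; split=> [/mapP [i + ->]|Ax].
    by rewrite mem_iota add0n /= => im; apply: fA.
  by have [i im <-] := fS _ Ax; rewrite map_f // mem_iota.
have L_sorted : sorted <%O L.
  rewrite sort_lt_sorted map_inj_in_uniq ?iota_uniq // => i j.
  by rewrite !mem_iota !add0n /= => im jm; apply: fI; rewrite inE.
exists (nth 0 L); split=> [|i j ij jm].
  apply/seteqP; split=> [x /memL xL|_ [i /= im <-]].
    by exists (index x L); rewrite /= ?nth_index // -sL index_mem.
  by apply/memL/mem_nth; rewrite sL.
by apply: (sorted_ltn_nth lt_trans) => //; rewrite inE sL // (ltn_trans ij).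
Qed.

Lemma sgr_neqN (x y : R) : x != 0 -> y != 0 -> Num.sg x <> Num.sg y ->
  Num.sg y = - Num.sg x.
Proof.
by do 2 case: sgrP => // _; rewrite ?opprK.
Qed.

(** Concatenating the blocks lists T in increasing order. The sign is constant on the long block,
    and it switches after each singleton block by maximality of that block. *)
Lemma decomposition_enumeration r d n T (xi : 'rV[R]_d.+1)
    (I : 'I_r.+1 -> set R) :
  (r < n)%N -> (forall t, T t -> q xi t != 0) ->
  signed_decomposition T xi I ->
  (forall k : 'I_r.+1, (k < r)%N -> I k #= `I_1) ->
  I ord_max #= `I_(n - r) ->
  exists u : nat -> R, [/\ T = u @` `I_n,
    forall i j, (i < j)%N -> (j < n)%N -> u i < u j &
    forall i, (i < n)%N ->
      Num.sg (q xi (u i)) = Num.sg (q xi (u 0%N)) * (-1) ^+ minn i r].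
Proof.
move=> rn qT [TE Imax Iord] I1 Ir.
(* The points of the singleton blocks; from index [r] on the value is a dummy. *)
have [x xE] : {x : nat -> R & forall i, (i < r)%N -> I (inord i) = [set x i]}.
  apply: (@choice _ _ (fun i t => (i < r)%N -> I (inord i) = [set t])) => i.
  case: (ltnP i r) => [ir|_]; last by exists 0.
  have [|f [-> _]] := @increasing_enumeration (I (inord i)) 1.
    by apply: I1; rewrite inordK // ltnW.
  by exists (f 0%N) => _; rewrite II1 image_set1.
have [y [yE y_incr]] := increasing_enumeration Ir.
pose u i := if (i < r)%N then x i else y (i - r)%N.
have uI i : (i < n)%N -> I (inord (minn i r)) (u i).
  move=> im; rewrite /u; case: (ltnP i r) => ir; first by rewrite xE.
  have -> : inord r = ord_max :> 'I_r.+1 by apply/val_inj; rewrite /= inordK.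
  by rewrite yE; exists (i - r)%N => //=; apply: ltn_sub2r.
have u_incr i j : (i < j)%N -> (j < n)%N -> u i < u j.
  move=> ij jn; case: (ltnP i r) => ir.
    apply: Iord (uI _ (ltn_trans ij jn)) (uI _ jn).
    by rewrite !inordK ?ltnS ?geq_minr //; lia.
  rewrite /u ltnNge ir /= ltnNge (leq_trans ir (ltnW ij)) /=.
  by apply: y_incr; lia.
have TuE : T = u @` `I_n.
  apply/seteqP; split=> [t|_ [i im <-]]; rewrite TE; last first.
    by exists (inord (minn i r)) => //; apply: uI.
  move=> [k _]; case: (ltnP k r) => kr Ik.
    exists (val k); first by rewrite /= (ltn_trans kr).
    by move: Ik; rewrite /u kr -[k]inord_val xE ?inord_val //.
  have km : k = ord_max by apply/val_inj/eqP; rewrite eqn_leq kr -ltnS ltn_ord.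
  move: Ik; rewrite km yE => -[i /= im <-]; exists (r + i)%N => /=.
    by rewrite -ltn_subRL.
  by rewrite /u ltnNge leq_addr /= addKn.
exists u; split=> //; elim=> [|i IH] im; first by rewrite min0n mulr1.
have uT j : (j < n)%N -> T (u j) by move=> jn; rewrite TuE; exists j.
have im' := ltnW im; have := IH im'.
case: (ltnP i r) => ir sgi; last first.
  rewrite (minn_idPr (leqW ir)) -sgi.
  have [[_ _ _ sgc] _] := Imax (inord r).
  have := uI _ im; have := uI _ im'.
  by rewrite (minn_idPr ir) (minn_idPr (leqW ir)) => ? ?; apply: sgc.
rewrite (minn_idPl ir) exprS mulrCA mulN1r -sgi.
apply: sgr_neqN; [exact/qT/uT|exact/qT/uT|move=> sgE].
(* With equal signs, u_i and u_(i+1) would form a sign run strictly larger than the block of u_i. *)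
have [_ /(_ (I (inord i) `|` [set u i.+1]))] := Imax (inord i).
have uiE : I (inord i) = [set u i] by rewrite xE // /u ir.
have ui1 := u_incr _ _ (ltnSn i) im.
rewrite uiE => H; suff /H : sign_run T xi ([set u i] `|` [set u i.+1]).
  move=> /(_ (@subsetUl _ _ _)) e.
  have : ([set u i] `|` [set u i.+1]) (u i.+1) by right.
  by rewrite e /= => ui; move: ui1; rewrite ui ltxx.
split.
- by move=> _ [->|->]; apply: uT.
- by exists (u i); left.
(* No point of T lies strictly between u_i and u_(i+1). *)
- move=> a b c; rewrite TuE => /= aJ bJ [m /= mn <-] /andP[am mb]; exfalso.
  have u_lt j k : (j < n)%N -> (k < n)%N -> u j < u k -> (j < k)%N.
    move=> jn kn; apply: contraTT; rewrite -leqNgt -leNgt leq_eqVlt.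
    by move=> /orP[/eqP -> //|kj]; apply/ltW/u_incr.
  by case: aJ am => ->; case: bJ mb => -> /u_lt -/(_ mn) H1 /u_lt H2;
    have := H1 _; have := H2 _ mn; lia.
- by move=> a b [->|->] [->|->].
Qed.

End Enumeration.

(** * Reduction of the chamber setting to alternating signs *)

Theorem theorem3p19 (R : realType) (d n : nat) (T : set R)
    (sigma : set 'rV[R]_d.+1) (xi : 'rV[R]_d.+1) (I : 'I_(d - 2) -> set R) :
  (3 <= d)%N -> (d.+1 <= n)%N -> T #= `I_n ->
  chamber T sigma -> interior sigma xi ->
  signed_decomposition T xi I ->
  (forall k : 'I_(d - 2), (k < d - 3)%N -> I k #= `I_1) ->
  (forall k : 'I_(d - 2), k = (d - 3)%N :> nat -> I k #= `I_(n - (d - 3))) ->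
  [/\ has_dim (veronese_polytope T xi) d,
      stacked d (veronese_polytope T xi) &
      vertices (veronese_polytope T xi) #= `I_n].
Proof.
(* With d = r + 3, [r] is both the number of singleton blocks and the index of the long block. *)
case: d sigma xi I => [|[|[|r]]] // sigma xi I _ rn _ ch ixi dec I1 Ir.
have qT t : T t -> q xi t != 0 by exact: interior_chamber_neq0 ixi.
have d3 : (r.+3 - 3 = r)%N by rewrite !subSS subn0.
rewrite d3 in I1 Ir.
have rn' : (r < n)%N by lia.
have [u [TE u_incr q_sign]] :=
  @decomposition_enumeration R r r.+3 n T xi I rn' qT dec I1 (Ir ord_max erefl).
have u0 : q xi (u 0%N) != 0 by apply: qT; rewrite TE; exists 0%N => //=; lia.
have -> : veronese_polytope T xi =
    conv ((fun i => (q xi (u i))^-1 *: veronese r.+3 (u i)) @` `I_n).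
  by rewrite /veronese_polytope TE image_comp.
apply: (alternating_stacked rn u_incr _ _ q_sign); last exact: sgr_id.
by rewrite sgr_eq0.
Qed.
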